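(* Let $\alpha,\beta\in(0,0.1)$ and let $\mathfrak{P}$ be a finite set of distributions over a domain $\mathcal{Z}$. Then, for any $\varepsilon>0$, there exists an $\varepsilon$-user-level DP algorithm for hypothesis selection which, when each of $n$ users has $m$ i.i.d. samples from an unknown distribution $\mathcal{D}$ over $\mathcal{Z}$ satisfying $\min_{\mathcal{P}'\in\mathfrak{P}}d_{\mathrm{TV}}(\mathcal{P}',\mathcal{D})\le0.1\alpha$, outputs with probability $1-\beta$ some $\mathcal{P}\in\mathfrak{P}$ with $d_{\mathrm{TV}}(\mathcal{P},\mathcal{D})\le\alpha$, as long as \[ n\ge\tilde{\Theta}\left(\frac{\log(|\mathfrak{P}|/\beta)}{\varepsilon}+\frac{\log(|\mathfrak{P}|/\beta)}{\alpha\varepsilon\sqrt{m}}+\frac{\log(|\mathfrak{P}|/\beta)}{\alpha^2 m}\right). \]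
   Context: User-level DP: there are $n$ users each holding $m$ examples from $\mathcal{Z}$; two inputs in $\mathcal{Z}^{nm}$ are user-level neighbors if they differ only in one user's $m$ examples; an algorithm is $\varepsilon$-user-level DP if $\Pr[\mathbf{A}(\mathbf{x})\in S]\le e^\varepsilon\Pr[\mathbf{A}(\mathbf{x}')\in S]$ for all neighbors and all output sets $S$. $d_{\mathrm{TV}}$ is total variation distance. $\tilde{\Theta}$ hides polylogarithmic factors. *)

(* Defs.v *)
From HB Require Import structures.
From mathcomp Require Import all_boot all_order all_algebra finmap.
From mathcomp Require Import all_classical all_reals all_analysis.

Set Implicit Arguments.
Unset Strict Implicit.
Unset Printing Implicit Defensive.
Import Order.TTheory GRing.Theory Num.Theory.

Local Open Scope classical_set_scope.
Local Open Scope ring_scope.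

Section iid.
Context (d : measure_display) (T : measurableType d) (R : realType).

Definition tuple_cons (n : nat) (x : T * n.-tuple T) : n.+1.-tuple T :=
  [tuple of x.1 :: x.2].

Lemma measurable_tuple_cons (n : nat) :
  measurable_fun [set: T * n.-tuple T] (@tuple_cons n).
Proof. by apply: measurable_cons; [exact: measurable_fst | exact: measurable_snd]. Qed.

HB.instance Definition _ (n : nat) :=
  isMeasurableFun.Build _ _ _ _ (@tuple_cons n) (@measurable_tuple_cons n).

Variable P : probability T R.

(* The n-fold product measure P^n, i.e. the law of n i.i.d. samples from P. *)
Fixpoint iid (n : nat) : probability (n.-tuple T) R :=
  match n with
  | 0 => dirac [tuple]
  | n.+1 => distribution (P \x iid n)%E (@tuple_cons n)
  end.

(* iid n is characterized by its values on measurable boxes. *)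
Lemma iidE (n : nat) (B : 'I_n -> set T) : (forall i, measurable (B i)) ->
  iid n [set x | forall i, B i (tnth x i)] = (\prod_(i < n) P (B i))%E.
Proof.
elim: n B => [|n IHn] B mB /=.
  by rewrite big_ord0 diracE mem_set//= => -[].
rewrite big_ord_recl -IHn; last by move=> i; exact: mB.
rewrite /distribution /pushforward -product_measure1E//.
  congr (_ _); apply/seteqP; split => -[x y] /=.
    move=> H; split; first exact: (H ord0).
    by move=> i; have := H (lift ord0 i); rewrite tnthS.
  move=> [Bx By] i; case: (unliftP ord0 i) => [j ->|->//].
  by rewrite tnthS; exact: By.
rewrite [X in measurable X](_ : _ =
    \bigcap_(i in [set: 'I_n]) ((@tnth n T ^~ i) @^-1` B (lift ord0 i))).
  apply: fin_bigcap_measurable => // i _; rewrite -[X in measurable X]setTI.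
  exact: measurable_tnth.
by apply/seteqP; split => x H i /=; [move=> _|]; exact: H.
Qed.

End iid.

Definition dTV (d : measure_display) (T : measurableType d) (R : realType)
    (P Q : probability T R) : \bar R :=
  ereal_sup [set `|P A - Q A|%E | A in measurable].

(* Distributions regarded as outputs of an algorithm: every set of outputs is
   an event. *)
Definition hypothesis (d : measure_display) (T : measurableType d)
  (R : realType) : Type := probability T R.

HB.instance Definition _ (d : measure_display) (T : measurableType d)
  (R : realType) := Pointed.copy (hypothesis T R) (pprobability T R).
HB.instance Definition _ (d : measure_display) (T : measurableType d)
    (R : realType) :=
  @isMeasurable.Build default_measure_display (hypothesis T R)
    discrete_measurable discrete_measurable0
    discrete_measurableC discrete_measurableU.

(* tnth x i is the list of the m examples held by user i. *)
Notation dataset T n m := (n.-tuple (m.-tuple T)).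

Definition user_neighbors (T : Type) (n m : nat) (x x' : dataset T n m) : Prop :=
  exists i : 'I_n, forall j : 'I_n, j != i -> tnth x j = tnth x' j.

Definition user_level_DP (d d' : measure_display) (T : measurableType d)
    (Y : measurableType d') (R : realType) (n m : nat) (eps : R)
    (A : R.-pker (dataset T n m) ~> Y) : Prop :=
  forall x x' : dataset T n m, user_neighbors x x' ->
  forall S : set Y, measurable S -> (A x S <= (expR eps)%:E * A x' S)%E.

Definition sample_complexity (R : realType) (k m : nat) (alpha beta eps : R) : R :=
  let L := ln (k%:R / beta) in
  L / eps + L / (alpha * eps * Num.sqrt m%:R) + L / (alpha ^+ 2 * m%:R).

(* C f log^c f, the functions in the class \tilde\Theta(f); the shift makes the
   logarithmic factor at least 1 for every f >= 0. *)
Definition polylog_scaled (R : realType) (C : R) (c : nat) (f : R) : R :=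
  C * f * (1 + ln (1 + f)) ^+ c.

(* Main.v *)
Require Import Defs.
From HB Require Import structures.
From mathcomp Require Import all_boot all_order all_algebra finmap.
From mathcomp Require Import all_classical all_reals all_analysis.
From mathcomp Require Import measurable_realfun ring lra.

(** For every ordered pair (P, Q) of hypotheses fix a nearly optimal set S
    distinguishing Q from P.  Each user reports the frequency of S among her m
    examples, centered at P(S) and clipped at tau = 6 (alpha + 1 / sqrt m); the
    deviation of (P, Q) is the sum over the users of this statistic minus its
    exact mean under P.  The score of P is its largest deviation, and a
    hypothesis is drawn by the exponential mechanism applied to the scores: one
    user moves a score by at most 2 tau.

    As a function of the success probability, the mean of the clipped binomial
    frequency is nondecreasing and 1-Lipschitz, and near P(S) its slope is at
    least 1/2 because, by Chebyshev, half of the mass stays in the unclipped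
    window; hence the clipping bias costs no logarithm, and the constants are
    C = 6400 and c = 0.  The clipped sum still varies by at most 1/m per
    example, so that its moment generating function yields deviations of order
    alpha n outside an event of probability exp(-Omega(n m alpha^2)). *)

Set Implicit Arguments.
Unset Strict Implicit.
Unset Printing Implicit Defensive.
Import Order.TTheory GRing.Theory Num.Theory.

Local Open Scope classical_set_scope.
Local Open Scope ring_scope.

(** * Binomial expectations as iterates of a one-trial averaging operator *)

Section bernoulli_operator.
Context (R : realType).
Implicit Types (p q a b c w lam delta : R) (f g : R -> R) (m : nat).

Definition bern_mean p f w : R := (1 - p) * f w + p * f (w + 1).

(* [bin_mean p m f w] is the expectation of [f (w + B)] for [B ~ Bin(m, p)]. *)
Definition bin_mean p m f : R -> R := iter m (bern_mean p) f.

(** Only unit steps matter, since a binomial mean started at [w] evaluates [f] at [w], [w + 1],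
    [w + 2] and so on. *)
Definition slow_growth delta f := forall w, 0 <= f (w + 1) - f w <= delta.

Lemma bin_meanS p m f w : bin_mean p m.+1 f w = bern_mean p (bin_mean p m f) w.
Proof. by []. Qed.

Lemma le_bern_mean p f g w : 0 <= p <= 1 -> (forall v, f v <= g v) ->
  bern_mean p f w <= bern_mean p g w.
Proof.
move=> /andP[p0 p1] fg; rewrite /bern_mean lerD// ler_wpM2l//; lra.
Qed.

Lemma bin_mean_ge0 p m f w : 0 <= p <= 1 -> (forall v, 0 <= f v) ->
  0 <= bin_mean p m f w.
Proof.
move=> p01 f0; elim: m w => [//|m IH] w; rewrite bin_meanS /bern_mean.
by rewrite addr_ge0// mulr_ge0//; lra.
Qed.

Lemma slow_growth_bern_mean delta p f : 0 <= p <= 1 ->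
  slow_growth delta f -> slow_growth delta (bern_mean p f).
Proof.
move=> p01 sf w; rewrite /bern_mean; have := sf w; have := sf (w + 1); nra.
Qed.

Lemma slow_growth_bin_mean delta p m f : 0 <= p <= 1 ->
  slow_growth delta f -> slow_growth delta (bin_mean p m f).
Proof.
by move=> p01 sf; elim: m => // m IH; exact: slow_growth_bern_mean.
Qed.

(** Switching one trial from [p] to [q] changes the mean by [q - p] times a unit increment of a
    binomial mean, which lies between 0 and [delta]; the [m] trials are switched one by one. *)
Lemma bin_mean_monotone_lipschitz delta p q m f w :
  0 <= p -> p <= q -> q <= 1 -> slow_growth delta f ->
  0 <= bin_mean q m f w - bin_mean p m f w <= m%:R * delta * (q - p).
Proof.
move=> p0 pq q1 sf; elim: m w => [|m IH] w; first by rewrite /=; lra.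
have q01 : 0 <= q <= 1 by lra.
have := slow_growth_bin_mean m q01 sf w.
rewrite !bin_meanS /bern_mean -(natr1 m); have := IH w; have := IH (w + 1).
set x := bin_mean q m f w; set y := bin_mean q m f (w + 1).
set x' := bin_mean p m f w; set y' := bin_mean p m f (w + 1).
set M := m%:R * delta * (q - p) => h1 h2 h3.
have -> : (m%:R + 1) * delta * (q - p) = M + delta * (q - p).
  by rewrite /M; ring.
nra.
Qed.

(** Averaging the quadratic penalty gives squared bias plus variance, and a binomial variance is at
    most [m / 4]. *)
Lemma bin_mean_increment a b c p m f : 0 <= p <= 1 -> 0 <= a ->
  (forall v, b - a * (v - c) ^+ 2 <= f (v + 1) - f v) ->
  forall w, b - a * ((w - c + m%:R * p) ^+ 2 + m%:R / 4) <=
            bin_mean p m f (w + 1) - bin_mean p m f w.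
Proof.
move=> p01 a0 hf; elim: m => [|m IH] w.
  by have := hf w; rewrite !mul0r !addr0.
rewrite !bin_meanS /bern_mean -(natr1 m); have := IH w; have := IH (w + 1).
set x := bin_mean p m f w; set y := bin_mean p m f (w + 1).
set z := bin_mean p m f (w + 1 + 1) => h1 h2.
have : bern_mean p (fun v => b - a * ((v - c + m%:R * p) ^+ 2 + m%:R / 4)) w
   <= bern_mean p (fun v => bin_mean p m f (v + 1) - bin_mean p m f v) w.
  exact: le_bern_mean.
rewrite {2}/bern_mean -/x -/y -/z => h.
have -> : (1 - p) * y + p * z - ((1 - p) * x + p * y) =
  (1 - p) * (y - x) + p * (z - y) by ring.
apply: le_trans h; rewrite /bern_mean.
(* Each trial adds the variance [p * (1 - p)], bounded by 1/4. *)
have h4 : p * (1 - p) <= 1 / 4 by have := sqr_ge0 (p - 1 / 2); lra.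
have h5 : a * (p * (1 - p)) <= a * (1 / 4) by rewrite ler_wpM2l.
rewrite -subr_ge0; set lhs := (X in 0 <= X).
have -> : lhs = a * (1 / 4) - a * (p * (1 - p)) by rewrite /lhs; field.
by rewrite subr_ge0.
Qed.

(* The difference telescopes over the number of trials with parameter [q]. *)
Lemma bin_mean_telescope a b c p q m f : 0 <= p -> p <= q -> q <= 1 -> 0 <= a ->
  (forall v, b - a * (v - c) ^+ 2 <= f (v + 1) - f v) ->
  forall w, (q - p) * \sum_(j < m)
      (b - a * ((w - c + j%:R * q + (m%:R - 1 - j%:R) * p) ^+ 2 + m%:R / 4))
    <= bin_mean q m f w - bin_mean p m f w.
Proof.
move=> p0 pq q1 a0 hf; elim: m => [|m IH] w.
  by rewrite big_ord0 mulr0 subrr.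
have q01 : 0 <= q <= 1 by lra.
have p01 : 0 <= p <= 1 by lra.
pose G v := bin_mean q m f v - bin_mean p m f v.
(* Peel off one trial: it either keeps parameter [p], with the induction hypothesis for the rest, or
   pays for its own switch while all others already have parameter [q]. *)
have -> : bin_mean q m.+1 f w - bin_mean p m.+1 f w =
    bern_mean p G w + (q - p) * (bin_mean q m f (w + 1) - bin_mean q m f w).
  by rewrite !bin_meanS /bern_mean /G; ring.
rewrite big_ord_recr/= mulrDr lerD//.
  apply: le_trans (le_bern_mean w p01 IH).
  rewrite [leRHS](_ : _ = (q - p) * \sum_(j < m) bern_mean p (fun v =>
     (b - a * ((v - c + j%:R * q + (m%:R - 1 - j%:R) * p) ^+ 2 + m%:R / 4))) w).
    rewrite ler_wpM2l ?subr_ge0//; apply: ler_sum => j _.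
    rewrite /bern_mean -(natr1 m).
    have h4 : p * (1 - p) <= 1 / 4 by have := sqr_ge0 (p - 1 / 2); lra.
    have h5 : a * (p * (1 - p)) <= a * (1 / 4) by rewrite ler_wpM2l.
    rewrite -subr_ge0; set lhs := (X in 0 <= X).
    have -> : lhs = a * (1 / 4) - a * (p * (1 - p)) by rewrite /lhs; field.
    by rewrite subr_ge0.
  by rewrite /bern_mean [in RHS]big_split/= -!mulr_sumr; ring.
rewrite ler_wpM2l ?subr_ge0//.
apply: le_trans (bin_mean_increment m q01 a0 hf w).
have h5 : a * (m%:R / 4) <= a * (m.+1%:R / 4).
  by rewrite ler_wpM2l// ler_pM2r ?invr_gt0 ?ltr0n// ler_nat.
rewrite -(natr1 m) in h5 *.
rewrite (_ : m%:R + 1 - 1 - m%:R = 0 :> R); last by ring.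
by rewrite mul0r addr0; lra.
Qed.

(** From [expR (- x) >= 1 - x] one gets [expR x * (1 - x) <= 1], while the quadratic times [1 - x]
    is [1 + x ^+ 2 * (1 - 2 * x)]. *)
Lemma expR_le_quadratic (x : R) : x <= 1 / 2 -> expR x <= 1 + x + 2 * x ^+ 2.
Proof.
move=> x2.
have h : 1 - x <= (expR x)^-1 by rewrite -expRN; exact: expR_ge1Dx.
have e0 := expR_gt0 x.
have h1 : expR x * (1 - x) <= 1.
  by rewrite -[leRHS](mulfV (lt0r_neq0 e0)) ler_wpM2l// ltW.
suff : expR x * (1 - x) <= (1 + x + 2 * x ^+ 2) * (1 - x).
  by rewrite ler_pM2r//; lra.
apply: (le_trans h1); rewrite -subr_ge0.
rewrite [leRHS](_ : _ = x ^+ 2 * (1 - 2 * x)); last by ring.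
by rewrite mulr_ge0 ?sqr_ge0//; lra.
Qed.

(** Once the mean is factored out, the two exponents are [- (p * u)] and [(1 - p) * u]; their linear
    terms cancel on average and the quadratic ones leave a variance. *)
Lemma bern_mean_expR delta p f lam w : 0 <= p <= 1 -> slow_growth delta f ->
  `|lam| * delta <= 1 / 2 ->
  bern_mean p (fun v => expR (lam * f v)) w <=
  expR (lam * bern_mean p f w + 2 * (lam * delta) ^+ 2).
Proof.
move=> p01 sf ld.
set u := lam * (f (w + 1) - f w).
have hd : `|u| <= `|lam| * delta.
  by have /andP[s0 s1] := sf w; rewrite normrM ler_wpM2l// ger0_norm.
have hu := hd; have u2 : u ^+ 2 <= (lam * delta) ^+ 2.
  have d0 : 0 <= delta by have := sf w; lra.
  rewrite -(real_normK (num_real u)) -(real_normK (num_real (lam * delta))).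
  by rewrite lerXn2r ?nnegrE// (normrM lam delta) (ger0_norm d0).
have {hd}hu : - (1 / 2) <= u <= 1 / 2 by rewrite -ler_norml (le_trans hu).
have -> : bern_mean p (fun v => expR (lam * f v)) w =
  expR (lam * bern_mean p f w) *
   ((1 - p) * expR (- (p * u)) + p * expR ((1 - p) * u)).
  rewrite mulrDr !(mulrCA (expR _)) -!expRD /bern_mean /u.
  by congr (_ * expR _ + _ * expR _); ring.
rewrite expRD ler_wpM2l ?expR_ge0//.
have h1 : expR (- (p * u)) <= 1 + (- (p * u)) + 2 * (- (p * u)) ^+ 2.
  by apply: expR_le_quadratic; nra.
have h2 : expR ((1 - p) * u) <= 1 + (1 - p) * u + 2 * ((1 - p) * u) ^+ 2.
  by apply: expR_le_quadratic; nra.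
have : (1 - p) * expR (- (p * u)) + p * expR ((1 - p) * u) <=
       1 + 2 * (p * (1 - p)) * u ^+ 2.
  rewrite [leRHS](_ : _ = (1 - p) * (1 + (- (p * u)) + 2 * (- (p * u)) ^+ 2) +
       p * (1 + (1 - p) * u + 2 * ((1 - p) * u) ^+ 2)); last by ring.
  by rewrite lerD// ler_wpM2l//; lra.
move=> /le_trans; apply.
apply: (le_trans _ (expR_ge1Dx _)); rewrite lerD2l.
by have := sqr_ge0 u; nra.
Qed.

(** A bounded-differences argument: averaging preserves slow growth, so each trial contributes the
    same [2 * (lam * delta) ^+ 2]. *)
Lemma bin_mean_expR delta p m f lam w : 0 <= p <= 1 -> slow_growth delta f ->
  `|lam| * delta <= 1 / 2 ->
  bin_mean p m (fun v => expR (lam * f v)) w <=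
  expR (lam * bin_mean p m f w + 2 * m%:R * (lam * delta) ^+ 2).
Proof.
move=> p01 sf ld; elim: m w => [|m IH] w.
  by rewrite mulr0 mul0r addr0.
rewrite !bin_meanS; apply: (le_trans (le_bern_mean w p01 IH)).
set F := bin_mean p m f; set k := 2 * m%:R * _.
have -> : bern_mean p (fun v => expR (lam * F v + k)) w =
    bern_mean p (fun v => expR (lam * F v)) w * expR k.
  by rewrite /bern_mean !expRD; ring.
have := bern_mean_expR w p01 (slow_growth_bin_mean m p01 sf) ld.
rewrite -(ler_pM2r (expR_gt0 k)) => /le_trans; apply.
by rewrite -expRD ler_expR /k -(natr1 m) -/F; lra.
Qed.

End bernoulli_operator.

(** * Integrals over i.i.d. samples *)

Section iid_integral.
Context (d : measure_display) (T : measurableType d) (R : realType).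
Variable P : probability T R.
Local Open Scope ereal_scope.

Lemma integral_iidS (n : nat) (f : n.+1.-tuple T -> \bar R) :
  measurable_fun [set: n.+1.-tuple T] f -> (forall x, 0 <= f x) ->
  \int[iid P n.+1]_x f x =
  \int[P]_x \int[iid P n]_y f (tuple_cons (x, y)).
Proof.
move=> mf f0 /=; rewrite ge0_integral_distribution// fubini_tonelli1//=.
by apply: measurableT_comp => //; exact: measurable_tuple_cons.
Qed.

Lemma integral_iid_prod (n : nat) (f : T -> R) (M : R) :
  measurable_fun [set: T] f -> (forall x, (0 <= f x)%R) ->
  \int[P]_x (f x)%:E = M%:E ->
  \int[iid P n]_x (\prod_(i < n) f (tnth x i))%:E = (M ^+ n)%:E.
Proof.
move=> mf f0 fM.
have mprod k : measurable_fun [set: k.-tuple T]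
    (fun x => (\prod_(i < k) f (tnth x i))%:E).
  apply/measurable_EFinP; apply: measurable_prod => i _.
  by apply: (measurableT_comp mf); exact: measurable_tnth.
have prod0 k (x : k.-tuple T) : (0 <= \prod_(i < k) f (tnth x i))%R.
  exact: prodr_ge0.
elim: n => [|n IH].
  under eq_integral do rewrite big_ord0.
  rewrite integral_cst//.
  by rewrite [X in _ * X](@probability_setT _ _ _ (iid P 0)) mule1.
rewrite integral_iidS//; last by move=> x; rewrite lee_fin.
have inner x : \int[iid P n]_y
    (\prod_(i < n.+1) f (tnth (tuple_cons (x, y)) i))%:E =
    (M ^+ n)%:E * (f x)%:E.
  rewrite -IH muleC -ge0_integralZl_EFin//; last 2 first.
  - by move=> y _; rewrite lee_fin.
  - exact: mprod.
  apply: eq_integral => y _; rewrite big_ord_recl EFinM.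
  by congr (_ * _%:E); apply: eq_bigr => i _; rewrite tnthS.
under eq_integral do rewrite inner.
rewrite /= ge0_integralZl_EFin//.
- by rewrite fM exprS mulrC.
- by move=> x _; rewrite lee_fin.
- exact/measurable_EFinP.
- by rewrite exprn_ge0// -lee_fin -fM integral_ge0// => x _; rewrite lee_fin.
Qed.

Definition hits (S : set T) (n : nat) (x : n.-tuple T) : R :=
  (\sum_(j < n) \1_S (tnth x j))%R.

Lemma measurable_hits (S : set T) (n : nat) : measurable S ->
  measurable_fun [set: n.-tuple T] (@hits S n).
Proof.
move=> mS; apply: measurable_sum => j.
apply: (@measurableT_comp _ _ _ _ _ _ (\1_S : T -> R)).
  exact: measurable_indic.
exact: measurable_tnth.
Qed.

Lemma integral_bern_mean (S : set T) (f : R -> R) (w : R) : measurable S ->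
  (forall v, (0 <= f v)%R) ->
  \int[P]_x (f (w + \1_S x)%R)%:E = (bern_mean (fine (P S)) f w)%:E.
Proof.
move=> mS f0.
have PS : P S = (fine (P S))%:E by rewrite fineK// fin_num_measure.
under eq_integral => x _.
  rewrite (_ : (f _)%:E = (f w)%:E * (\1_(~` S) x)%:E
     + (f (w + 1)%R)%:E * (\1_S x)%:E); last first.
    rewrite -!EFinM -EFinD; congr EFin; rewrite !indicE in_setC.
    by case: (x \in S) => /=; rewrite ?mulr1 ?mulr0 ?addr0 ?add0r.
  over.
rewrite /= ge0_integralD//=; last 4 first.
- by move=> x _; rewrite -EFinM lee_fin mulr_ge0.
- apply: emeasurable_funM => //; apply/measurable_EFinP.
  by apply: measurable_indic; exact: measurableC.
- by move=> x _; rewrite -EFinM lee_fin mulr_ge0.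
- apply: emeasurable_funM => //; apply/measurable_EFinP.
  exact: measurable_indic.
rewrite !ge0_integralZl_EFin//; try by move=> x _; rewrite lee_fin.
- rewrite !integral_indic//; last exact: measurableC.
  rewrite !setIT [X in _ * X + _](probability_setC P mS).
  rewrite [X in _ + _ * X]PS PS -EFinB -!EFinM -EFinD /bern_mean.
  by rewrite mulrC (mulrC (f (w + 1)))%R.
- by apply/measurable_EFinP; exact: measurable_indic.
- by apply/measurable_EFinP; apply: measurable_indic; exact: measurableC.
Qed.

(** Turns integrals over samples into the binomial operator. The offset [w] drives the induction:
    the first example shifts it by its indicator. *)
Lemma integral_hits (S : set T) (n : nat) (f : R -> R) (w : R) :
  measurable S -> measurable_fun [set: R] f -> (forall v, (0 <= f v)%R) ->
  \int[iid P n]_x (f (w + hits S x)%R)%:E = (bin_mean (fine (P S)) n f w)%:E.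
Proof.
move=> mS mf f0.
have P01 : (0 <= fine (P S) <= 1)%R.
  by rewrite fine_ge0//= -lee_fin fineK ?fin_num_measure// probability_le1.
elim: n w => [|n IH] w.
  under eq_integral do rewrite /hits big_ord0 addr0.
  rewrite integral_cst//.
  by rewrite [X in _ * X](@probability_setT _ _ _ (iid P 0)) mule1.
rewrite integral_iidS; last 2 first.
- apply/measurable_EFinP; apply: (measurableT_comp mf).
  by apply: measurable_funD => //; exact: measurable_hits.
- by move=> x; rewrite lee_fin.
have inner x : \int[iid P n]_y (f (w + hits S (tuple_cons (x, y)))%R)%:E =
    (bin_mean (fine (P S)) n f (w + \1_S x))%:E.
  rewrite -IH; apply: eq_integral => y _.
  rewrite /hits big_ord_recl addrA; congr (f (_ + _)%R)%:E.
  by apply: eq_bigr => i _; rewrite tnthS.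
under eq_integral do rewrite inner.
by rewrite integral_bern_mean// => v; exact: bin_mean_ge0.
Qed.

End iid_integral.

(** * Probability kernels with finite support *)

Section finite_kernel.
Context (d d' : measure_display) (X : measurableType d) (Y : measurableType d').
Context (R : realType).
Local Open Scope ereal_scope.

(** The kernel is a finite sum of Dirac masses scaled by the weights, so its measurability is that
    of the weights. *)
Lemma exists_mixture_kernel (s : seq Y) (w : Y -> X -> R) :
  (forall y x, (0 <= w y x)%R) ->
  (forall y, measurable_fun [set: X] (w y)) ->
  (forall x, \sum_(y <- s) w y x = 1)%R ->
  exists A : R.-pker X ~> Y, forall x S,
    A x S = (\sum_(y <- s) w y x * \1_S y)%:E.
Proof.
move=> w0 mw w1.
pose m x (i : nat) : {measure set Y -> \bar R} :=
  mscale (NngNum (w0 (nth point s i) x)) (dirac (nth point s i)).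
pose k x : {measure set Y -> \bar R} := msum (m x) (size s).
have kE x S : k x S = (\sum_(y <- s) w y x * \1_S y)%:E.
  rewrite /k /= /msum (big_nth point) big_mkord -sumEFin.
  apply: eq_bigr => i _.
  by rewrite /m /= /mscale /= diracE.
have mk U : measurable U -> measurable_fun [set: X] (k ^~ U).
  move=> mU; under eq_fun do rewrite kE.
  apply/measurable_EFinP; apply: measurable_sum => y.
  by apply: measurable_funM.
have k1 x : k x [set: Y] = 1.
  rewrite kE -(w1 x); congr EFin.
  by apply: eq_bigr => y _; rewrite indicT mulr1.
pose K1 := isKernel.Build _ _ _ _ _ k mk.
pose K := HB.pack_for (Kernel.type X Y R) k K1.
pose K2 := Kernel_isProbability.Build _ _ _ _ _ K k1.
pose A := HB.pack_for (R.-pker X ~> Y) k K1 K2.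
by exists A.
Qed.

End finite_kernel.

(** * The clipped frequency and its binomial mean *)

Section clipped_frequency.
Context (R : realType).
Implicit Types (tau p q alpha v w x y : R) (m : nat).

Definition clip tau x : R := Num.max (- tau) (Num.min tau x).

Lemma clip_bounds tau x : 0 <= tau -> - tau <= clip tau x <= tau.
Proof.
move=> t0; rewrite /clip le_max lexx/= ge_max ge_min lexx/= andbT; lra.
Qed.

Lemma clip_id tau x : - tau <= x <= tau -> clip tau x = x.
Proof. by move=> /andP[h1 h2]; rewrite /clip min_r// max_r. Qed.

Lemma clip_increment tau x y : x <= y -> 0 <= clip tau y - clip tau x <= y - x.
Proof.
move=> xy; rewrite /clip.
by case: (leP tau x) => ?; case: (leP tau y) => ?; case: (leP (- tau) tau) => ?;
  case: (leP (- tau) x) => ?; case: (leP (- tau) y) => ?; lra.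
Qed.

Lemma measurable_clip tau : measurable_fun [set: R] (clip tau).
Proof.
apply: measurable_maxr => //.
by apply: measurable_minr => //; exact: measurable_id.
Qed.

Definition clip_freq tau p m w : R := clip tau (w / m%:R - p).

Lemma measurable_clip_freq tau p m :
  measurable_fun [set: R] (clip_freq tau p m).
Proof.
apply: (measurableT_comp (measurable_clip tau)).
apply: measurable_funB => //; exact: measurable_funM.
Qed.

Lemma slow_growth_clip_freq tau p m : slow_growth m%:R^-1 (clip_freq tau p m).
Proof.
move=> w; rewrite /clip_freq; set x := w / _ - p.
have -> : (w + 1) / m%:R - p = x + m%:R^-1 by rewrite /x; lra.
have xy : x <= x + m%:R^-1 by rewrite lerDl.
by have := clip_increment tau xy; rewrite [x + _ - x]addrAC subrr add0r.
Qed.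

(** The parabola vanishes at distance [m%:R * tau / 2] from the center. Within that distance [v] and
    [v + 1] are both unclipped, since [2 <= m%:R * tau] leaves room for the unit step; beyond it,
    monotonicity suffices. *)
Lemma clip_freq_increment tau p m v : (0 < m)%N -> 2 <= m%:R * tau ->
  m%:R^-1 - (4 / (m%:R * (m%:R * tau) ^+ 2)) * (v - m%:R * p) ^+ 2 <=
  clip_freq tau p m (v + 1) - clip_freq tau p m v.
Proof.
move=> m0 t2.
have m0' : 0 < m%:R :> R by rewrite ltr0n.
have mV0 : 0 < m%:R^-1 :> R by rewrite invr_gt0.
have mn0 : m%:R != 0 :> R by rewrite lt0r_neq0.
set t := m%:R * tau; have t0 : 0 < t by rewrite /t; lra.
set s := v - m%:R * p.
have -> : m%:R^-1 - (4 / (m%:R * t ^+ 2)) * s ^+ 2 =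
   m%:R^-1 * (1 - 4 * s ^+ 2 / t ^+ 2).
  by field; rewrite mn0 lt0r_neq0.
have [st|st] := leP (2 * `|s|) t.
  have {st}st : - t <= 2 * s <= t.
    by rewrite -ler_norml normrM (@ger0_norm _ 2).
  have tauE : tau = m%:R^-1 * t by rewrite /t mulrA mulVf// mul1r.
  have vE : v / m%:R - p = m%:R^-1 * s by rewrite /s; field.
  have vE1 : (v + 1) / m%:R - p = m%:R^-1 * (s + 1) by rewrite /s; field.
  rewrite /clip_freq vE vE1 !clip_id; last 2 first.
  - by rewrite tauE -mulrN !ler_pM2l//; move: t2; rewrite -/t; lra.
  - by rewrite tauE -mulrN !ler_pM2l//; move: t2; rewrite -/t; lra.
  rewrite -mulrBr ler_pM2l// addrAC subrr add0r gerBl.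
  by rewrite divr_ge0 ?sqr_ge0// mulr_ge0 ?sqr_ge0.
apply: (@le_trans _ _ 0); last by case/andP: (slow_growth_clip_freq tau p m v).
rewrite pmulr_rle0// subr_le0 ler_pdivlMr ?exprn_gt0// mul1r.
have -> : 4 * s ^+ 2 = (2 * `|s|) ^+ 2.
  by rewrite exprMn real_normK ?num_real//; ring.
rewrite lerXn2r ?nnegrE//; exact: ltW.
Qed.

(* By Chebyshev, at least half of the mass of the binomial stays in the window
   where [clip_freq] has slope 1. *)
Lemma bin_mean_clip_gap alpha p q m : (0 < m)%N -> 0 <= alpha ->
  0 <= p -> p <= q -> q <= 1 -> q - p <= alpha ->
  let f := clip_freq (6 * (alpha + (Num.sqrt m%:R)^-1)) p m in
  (q - p) / 2 <= bin_mean q m f 0 - bin_mean p m f 0.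
Proof.
move=> m0 a0 p0 pq q1 qpa /=.
have m1 : 1 <= m%:R :> R by rewrite ler1n.
have m0' : 0 < m%:R :> R by rewrite ltr0n.
set r := Num.sqrt m%:R; set tau := 6 * _.
have r2 : r ^+ 2 = m%:R by rewrite sqr_sqrtr.
have r0 : 0 < r by rewrite sqrtr_gt0.
have r1 : 1 <= r by rewrite -[leLHS]sqrtr1 ler_sqrt.
have tE : m%:R * tau = 6 * (m%:R * alpha + r).
  by rewrite /tau -r2; field; rewrite lt0r_neq0.
set t := m%:R * tau in tE.
have ma0 : 0 <= m%:R * alpha by rewrite mulr_ge0.
have t2 : 2 <= t by rewrite tE; lra.
have tsq : 36 * ((m%:R * alpha) ^+ 2 + m%:R) <= t ^+ 2.
  have := mulr_ge0 ma0 (ltW r0); move: r2; rewrite tE; lra.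
have a40 : 0 <= 4 / (m%:R * t ^+ 2).
  by rewrite divr_ge0// mulr_ge0 ?sqr_ge0// ltW.
apply: le_trans (bin_mean_telescope m p0 pq q1 a40
  (fun v => @clip_freq_increment tau p m v m0 t2) 0).
rewrite ler_wpM2l ?subr_ge0//.
(* Each of the [m] telescoping terms keeps at least half of the full slope [m%:R^-1]. *)
apply: (@le_trans _ _ (\sum_(j < m) (m%:R^-1 / 2))).
  rewrite sumr_const card_ord -[leRHS]mulr_natl mulrA mulfV ?lt0r_neq0//; lra.
apply: ler_sum => j _.
have jm : j%:R <= m%:R :> R by rewrite ler_nat ltnW.
have j0 : 0 <= j%:R :> R by [].
have t20 : 0 < t ^+ 2 by rewrite exprn_gt0//; lra.
set z := 0 - _ + _ + _.
have zE : z = j%:R * (q - p) - p by rewrite /z; ring.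
have z2 : z ^+ 2 <= 1 + (m%:R * alpha) ^+ 2.
  have h1 : j%:R * (q - p) <= m%:R * alpha by rewrite ler_pM// subr_ge0.
  have h2 : 0 <= j%:R * (q - p) by rewrite mulr_ge0// subr_ge0.
  by rewrite zE; nra.
(* The factor 6 in [tau] gives 36 in [tsq], more than enough for the penalty to consume at most half
   of the slope. *)
have key : 4 * (z ^+ 2 + m%:R / 4) <= t ^+ 2 / 2 by nra.
have -> : 4 / (m%:R * t ^+ 2) * (z ^+ 2 + m%:R / 4) =
    m%:R^-1 * (4 * (z ^+ 2 + m%:R / 4) / t ^+ 2).
  by field; rewrite !lt0r_neq0//; lra.
rewrite -{2}(mulr1 m%:R^-1) -mulrBr ler_pM2l ?invr_gt0//.
have : 4 * (z ^+ 2 + m%:R / 4) / t ^+ 2 <= 1 / 2.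
  by rewrite ler_pdivrMr//; lra.
lra.
Qed.

End clipped_frequency.

(** * Exponential moments of sums over users *)

Section concentration.
Context (d : measure_display) (T : measurableType d) (R : realType).

Lemma bin_mean_subc (p c w : R) (m : nat) (f : R -> R) :
  bin_mean p m (fun v => f v - c) w = bin_mean p m f w - c.
Proof.
elim: m w => [//|m IH] w; rewrite !bin_meanS /bern_mean !IH; ring.
Qed.

(** Users are independent, so the moment is the [n]-th power of that of one user, bounded by
    [bin_mean_expR] with step [m%:R^-1]. The sign of [lam] selects the tail. *)
Lemma integral_exp_deviation (D : probability T R) (S : set T) (n m : nat)
    (f : R -> R) (lam mu a kappa : R) :
  measurable S -> measurable_fun [set: R] f -> slow_growth m%:R^-1 f ->
  (0 < m)%N -> `|lam| / m%:R <= 1 / 2 ->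
  lam * (bin_mean (fine (D S)) m f 0 - mu - a) + 2 * (lam ^+ 2 / m%:R)
    <= - kappa ->
  (\int[iid (iid D m) n]_x
     (expR (lam * (\sum_(i < n) (f (hits R S (tnth x i)) - mu) - n%:R * a)))%:E
   <= (expR (- (n%:R * kappa)))%:E)%E.
Proof.
move=> mS mf sf m0 lm hk.
have m0' : 0 < m%:R :> R by rewrite ltr0n.
pose h v := f v - (mu + a).
have mh : measurable_fun [set: R] h by exact: measurable_funB.
have sh : slow_growth m%:R^-1 h.
  by move=> w; have := sf w; rewrite /h; lra.
pose e v := expR (lam * h v).
have me : measurable_fun [set: R] e.
  apply: (measurableT_comp (@measurable_expR R)); exact: measurable_funM.
set q := fine (D S) in hk *.
have q01 : 0 <= q <= 1.
  by rewrite fine_ge0//= -lee_fin fineK ?fin_num_measure// probability_le1.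
set M := bin_mean q m e 0.
have Mk : M <= expR (- kappa).
  apply: (le_trans (bin_mean_expR m 0 q01 sh lm)); rewrite ler_expR.
  apply: le_trans hk; rewrite bin_mean_subc -/q.
  by rewrite (_ : 2 * m%:R * _ = 2 * (lam ^+ 2 / m%:R));
    [lra|field; rewrite lt0r_neq0].
have intM : (\int[iid D m]_y (e (hits R S y))%:E = M%:E)%E.
  rewrite -(integral_hits D m 0 mS me); last by move=> v; exact: expR_ge0.
  by apply: eq_integral => y _; rewrite add0r.
under eq_integral => x _.
  rewrite (_ : expR _ = \prod_(i < n) e (hits R S (tnth x i))); last first.
    rewrite -expR_sum; congr expR; rewrite -mulr_sumr; congr (_ * _).
    rewrite /h !sumrB !sumr_const card_ord; ring.
  over.
rewrite /= (integral_iid_prod (P := iid D m) n _ _ intM); last 2 first.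
- apply: (measurableT_comp me); exact: measurable_hits.
- by move=> y; exact: expR_ge0.
rewrite lee_fin -mulrN expRM_natl lerXn2r ?nnegrE ?expR_ge0//.
by apply: bin_mean_ge0 => // v; exact: expR_ge0.
Qed.

End concentration.

(** * The exponential mechanism *)

Section exponential_mechanism.
Context (R : realType) (Y : eqType).
Implicit Types (s : seq Y) (c a g delta : R) (u : Y -> R) (y : Y).

(** The score [u] is a penalty, hence the minus sign. *)
Definition exp_mech s c u y : R :=
  expR (- (c * u y)) / \sum_(y' <- s) expR (- (c * u y')).

Lemma exp_mech_ge0 s c u y : 0 <= exp_mech s c u y.
Proof. by rewrite divr_ge0 ?expR_ge0// sumr_ge0// => *; exact: expR_ge0. Qed.

Lemma le_exp_mech_norm s c u y0 : y0 \in s ->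
  expR (- (c * u y0)) <= \sum_(y <- s) expR (- (c * u y)).
Proof.
move=> ys; rewrite (big_rem y0)//= lerDl.
by rewrite sumr_ge0// => *; exact: expR_ge0.
Qed.

Lemma exp_mech_norm_gt0 s c u y0 : y0 \in s ->
  0 < \sum_(y <- s) expR (- (c * u y)).
Proof.
by move=> ys; apply: lt_le_trans (le_exp_mech_norm c u ys); exact: expR_gt0.
Qed.

Lemma exp_mech_sum1 s c u y0 : y0 \in s -> \sum_(y <- s) exp_mech s c u y = 1.
Proof.
by move=> ys; rewrite -mulr_suml mulfV// gt_eqF// (exp_mech_norm_gt0 c u ys).
Qed.

(** Numerator and normalizer each move by a factor of at most [expR (c * delta)], whence the 2. *)
Lemma exp_mech_private s c u u' delta y0 y : 0 <= c -> y0 \in s ->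
  (forall y, u y <= u' y + delta) -> (forall y, u' y <= u y + delta) ->
  exp_mech s c u y <= expR (2 * c * delta) * exp_mech s c u' y.
Proof.
move=> c0 ys h1 h2; rewrite /exp_mech.
set W := \sum_(_ <- _) _; set W' := \sum_(_ <- _) _.
have W0 : 0 < W by exact: exp_mech_norm_gt0 ys.
have W0' : 0 < W' by exact: exp_mech_norm_gt0 ys.
have cu v v' z : v z <= v' z + delta ->
    expR (- (c * v' z)) <= expR (c * delta) * expR (- (c * v z)).
  move=> h; rewrite -expRD ler_expR.
  by have := ler_wpM2l c0 h; lra.
have WW : W' <= expR (c * delta) * W.
  by rewrite mulr_sumr; apply: ler_sum => z _; exact: cu.
rewrite ler_pdivrMr// mulrA mulrAC ler_pdivlMr//.
have -> : expR (2 * c * delta) = expR (c * delta) * expR (c * delta).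
  by rewrite -expRD; congr expR; ring.
rewrite [leRHS](_ : _ = (expR (c * delta) * expR (- (c * u' y)))
   * (expR (c * delta) * W)); last by ring.
by apply: ler_pM => //; [exact: ltW|exact: cu].
Qed.

(** The normalizer is at least the term of [y0] alone, so each bad candidate has weight at most
    [expR (- (c * g))]. *)
Lemma exp_mech_utility s c u a g y0 (bad : pred Y) : 0 <= c -> y0 \in s ->
  u y0 <= a -> (forall y, y \in s -> bad y -> a + g <= u y) ->
  \sum_(y <- s | bad y) exp_mech s c u y <= (size s)%:R * expR (- (c * g)).
Proof.
move=> c0 ys ua ub.
apply: (@le_trans _ _ (\sum_(y <- s) expR (- (c * g)))); last first.
  by rewrite big_const_seq count_predT iter_addr_0 mulr_natl.
rewrite big_mkcond/= big_seq [leRHS]big_seq; apply: ler_sum => y yin.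
case: ifPn => [by_|_]; last exact: expR_ge0.
rewrite /exp_mech ler_pdivrMr ?(exp_mech_norm_gt0 c u ys)//.
apply: (@le_trans _ _ (expR (- (c * g)) * expR (- (c * u y0)))).
  rewrite -expRD ler_expR.
  by have := ler_wpM2l c0 (ub _ yin by_); have := ler_wpM2l c0 ua; lra.
by rewrite ler_wpM2l ?expR_ge0// le_exp_mech_norm.
Qed.

End exponential_mechanism.

(** * Total variation distance and distinguishing sets *)

Section total_variation.
Context (d : measure_display) (T : measurableType d) (R : realType).
Implicit Types (P Q D : probability T R) (A : set T) (a : R).

Definition prob P A : R := fine (P A).

Lemma prob_bounds P A : measurable A -> 0 <= prob P A <= 1.
Proof.
move=> mA; rewrite fine_ge0//= -lee_fin fineK ?fin_num_measure//.
exact: probability_le1.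
Qed.

Lemma distE P Q A : measurable A ->
  (`|P A - Q A| = (`|prob P A - prob Q A|)%:E)%E.
Proof. by move=> mA; rewrite -abse_EFin EFinB !fineK// fin_num_measure. Qed.

Lemma dTV_leP P Q a : (dTV P Q <= a%:E)%E <->
  forall A, measurable A -> `|prob P A - prob Q A| <= a.
Proof.
split=> [h A mA|h].
  rewrite -lee_fin -distE//; apply: le_trans h.
  by apply: ereal_sup_ubound; exists A.
by apply: ge_ereal_sup => _ [A mA <-]; rewrite distE// lee_fin h.
Qed.

Lemma dTV_fin_num P Q : dTV P Q \is a fin_num.
Proof.
rewrite ge0_fin_numE.
  apply: (@le_lt_trans _ _ 1%:E); last exact: ltry.
  apply/dTV_leP => A mA; rewrite ler_norml.
  by have := prob_bounds P mA; have := prob_bounds Q mA; lra.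
apply: le_trans (ereal_sup_ubound _); last by exists set0; [exact: measurable0|].
exact: abse_ge0.
Qed.

(** The slack [a] allows approaching the supremum instead of attaining it; passing to the complement
    fixes the sign of the difference. *)
Lemma near_Scheffe_set P Q a : 0 < a -> exists2 A, measurable A &
  (dTV P Q <= (prob Q A - prob P A + a)%:E)%E.
Proof.
move=> a0.
have [_ [A mA <-] h] := ub_ereal_sup_adherent a0 (dTV_fin_num P Q).
rewrite distE// lteBlDr// -EFinD in h.
have [pq|pq] := leP 0 (prob Q A - prob P A).
  by exists A => //; apply/ltW; rewrite distrC ger0_norm in h.
exists (~` A); first exact: measurableC.
rewrite /prob !probability_setC//; apply/ltW; apply: (lt_le_trans h).
rewrite lee_fin lerD2r ger0_norm; last by lra.
by rewrite !fineB ?fin_num_measure//=; rewrite /prob; lra.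
Qed.

(** By contraposition and the triangle inequality through [Q]; [e1] is paid twice, once on an
    arbitrary event and once on [A]. *)
Lemma Scheffe_set_gap P Q D A (e1 e2 : R) : measurable A ->
  (dTV Q D <= e1%:E)%E -> (dTV P Q <= (prob Q A - prob P A + e2)%:E)%E ->
  forall a, (a%:E < dTV P D)%E -> a - 2 * e1 - e2 <= prob D A - prob P A.
Proof.
move=> mA /dTV_leP QD /dTV_leP PQ a; apply: contraPle => h.
apply/negP; rewrite -leNgt; apply/dTV_leP => B mB.
rewrite -(subrKA (prob Q B)).
apply: (le_trans (ler_normD _ _)).
have := QD _ mA; rewrite ler_norml => hA.
by have := PQ _ mB; have := QD _ mB; lra.
Qed.

End total_variation.

(** * Union bounds in integral form *)

Section integral_bounds.
Context (d : measure_display) (X : measurableType d) (R : realType).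
Variable mu : probability X R.
Implicit Types (G H : X -> R).

Lemma integral_sum_le (I : eqType) (s : seq I) (E : I -> X -> R) (e : R) :
  (forall i, measurable_fun [set: X] (E i)) -> (forall i x, 0 <= E i x) ->
  (forall i, i \in s -> (\int[mu]_x (E i x)%:E <= e%:E)%E) ->
  (\int[mu]_x (\sum_(i <- s) E i x)%:E <= ((size s)%:R * e)%:E)%E.
Proof.
move=> mE E0 hE.
under eq_integral do rewrite -sumEFin.
rewrite ge0_integral_sum//; last 2 first.
- by move=> i; exact/measurable_EFinP.
- by move=> i x _; rewrite lee_fin.
rewrite mulr_natl -iter_addr_0 -(count_predT s) -big_const_seq -sumEFin.
by rewrite big_seq [leRHS]big_seq; exact: lee_sum.
Qed.

Lemma integral_add_le G H (g h : R) :
  measurable_fun [set: X] G -> (forall x, 0 <= G x) ->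
  measurable_fun [set: X] H -> (forall x, 0 <= H x) ->
  (\int[mu]_x (G x)%:E <= g%:E)%E -> (\int[mu]_x (H x)%:E <= h%:E)%E ->
  (\int[mu]_x (G x + H x)%:E <= (g + h)%:E)%E.
Proof.
move=> mG G0 mH H0 hg hh; under eq_integral do rewrite EFinD.
rewrite ge0_integralD//; last 4 first.
- by move=> x _; rewrite lee_fin.
- exact/measurable_EFinP.
- by move=> x _; rewrite lee_fin.
- exact/measurable_EFinP.
by rewrite EFinD leeD.
Qed.

(** Here [G] will be a success probability given the data and [H] a pointwise bound on failure, so
    that exponentials can stand in for bad events. *)
Lemma integral_ge_complement G H (h : R) :
  measurable_fun [set: X] G -> (forall x, 0 <= G x) ->
  measurable_fun [set: X] H -> (forall x, 0 <= H x) ->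
  (forall x, 1 <= G x + H x) -> (\int[mu]_x (H x)%:E <= h%:E)%E ->
  ((1 - h)%:E <= \int[mu]_x (G x)%:E)%E.
Proof.
move=> mG G0 mH H0 GH hh; rewrite EFinB leeBlDr//.
apply: (@le_trans _ _ (\int[mu]_x (G x)%:E + \int[mu]_x (H x)%:E)%E);
  last by rewrite leeD2l.
rewrite -ge0_integralD//; last 4 first.
- by move=> x _; rewrite lee_fin.
- exact/measurable_EFinP.
- by move=> x _; rewrite lee_fin.
- exact/measurable_EFinP.
rewrite (_ : 1%:E = \int[mu]_x 1%:E)%E; last first.
  by rewrite integral_cst// mul1e; apply/esym; exact: probability_setT.
apply: ge0_le_integral => //.
- by apply: emeasurable_funD; exact/measurable_EFinP.
- by move=> x _; rewrite -EFinD lee_fin.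
Qed.

End integral_bounds.

(** * Sensitivity to one user, and finite extrema *)

Lemma user_neighbors_sum (R : realType) (T : Type) (n m : nat) (tau mu : R)
    (F : m.-tuple T -> R) (x x' : dataset T n m) :
  (forall y, - tau <= F y <= tau) -> user_neighbors x x' ->
  \sum_(i < n) (F (tnth x i) - mu) <=
  \sum_(i < n) (F (tnth x' i) - mu) + 2 * tau.
Proof.
move=> hF [i0 hi]; rewrite (bigD1 i0)//= [X in _ <= X + _](bigD1 i0)//=.
rewrite (eq_bigr (fun i => F (tnth x' i) - mu)); last first.
  by move=> j ji; rewrite hi.
by have := hF (tnth x i0); have := hF (tnth x' i0); lra.
Qed.

Lemma user_neighbors_sym (T : Type) (n m : nat) (x x' : dataset T n m) :
  user_neighbors x x' -> user_neighbors x' x.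
Proof. by move=> [i hi]; exists i => j ji; rewrite hi. Qed.

Lemma bigmine_le_exists (R : realType) (I : eqType) (s : seq I)
    (f : I -> \bar R) (a : R) :
  (\big[mine/+oo]_(i <- s) f i <= a%:E)%E ->
  exists2 i, i \in s & (f i <= a%:E)%E.
Proof.
elim: s => [|i s IH]; first by rewrite big_nil leye_eq.
rewrite big_cons ge_min => /orP[fi|/IH[j js fj]].
  by exists i => //; exact: mem_head.
by exists j => //; rewrite in_cons js orbT.
Qed.

Lemma measurable_bigmaxr (d : measure_display) (X : measurableType d)
    (R : realType) (I : Type) (s : seq I) (f : I -> X -> R) (a : R) :
  (forall i, measurable_fun [set: X] (f i)) ->
  measurable_fun [set: X] (fun x => \big[Num.max/a]_(i <- s) f i x).
Proof.
move=> mf; elim: s => [|i s IH].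
  by under eq_fun do rewrite big_nil; exact: measurable_cst.
by under eq_fun do rewrite big_cons; exact: measurable_maxr.
Qed.

(** * The selection algorithm: measurability and sensitivity *)

Section hypothesis_selection.
Context (d : measure_display) (Z : measurableType d) (R : realType).
Variables (hyps : {fset hypothesis Z R}) (alpha beta eps : R) (n m : nat).
Implicit Types P Q : hypothesis Z R.
Variable S : hypothesis Z R -> hypothesis Z R -> set Z.
Hypothesis hyps0 : hyps != fset0.
Hypothesis alpha01 : 0 < alpha < 1 / 10.
Hypothesis beta01 : 0 < beta < 1 / 10.
Hypothesis eps0 : 0 < eps.
Hypothesis m0 : (0 < m)%N.
Hypothesis mS : forall P Q, measurable (S P Q).
Hypothesis S_dTV : forall P Q,
  (dTV P Q <= (prob Q (S P Q) - prob P (S P Q) + alpha / 100)%:E)%E.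

Let tau : R := 6 * (alpha + (Num.sqrt m%:R)^-1).
Let F P Q : R -> R := clip_freq tau (prob P (S P Q)) m.
Let mu P Q : R := bin_mean (prob P (S P Q)) m (F P Q) 0.
Let dev P Q (x : dataset Z n m) : R :=
  \sum_(i < n) (F P Q (hits R (S P Q) (tnth x i)) - mu P Q).
Let score (x : dataset Z n m) P : R := \big[Num.max/0]_(Q <- hyps) dev P Q x.
(** Scores have sensitivity [2 * tau], so this rate makes the privacy loss
    [2 * (eps / (4 * tau)) * (2 * tau) = eps]. *)
Let weight P (x : dataset Z n m) : R :=
  exp_mech hyps (eps / (4 * tau)) (score x) P.

Let m0R : 0 < m%:R :> R. Proof. by rewrite ltr0n. Qed.

Let tau0 : 0 < tau.
Proof.
rewrite mulr_gt0// addr_gt0 ?invr_gt0 ?sqrtr_gt0//; by case/andP: alpha01.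
Qed.

Let c0 : 0 <= eps / (4 * tau).
Proof. by apply: divr_ge0; [exact: ltW | rewrite mulr_ge0// ltW]. Qed.

Let measurable_dev P Q : measurable_fun [set: dataset Z n m] (dev P Q).
Proof.
apply: measurable_sum => i; apply: measurable_funB => //.
apply: (measurableT_comp (measurable_clip_freq _ _ _)).
apply: (@measurableT_comp _ _ _ _ _ _ (@hits _ Z R (S P Q) m)).
  exact: measurable_hits.
exact: measurable_tnth.
Qed.

Let measurable_weight P : measurable_fun [set: dataset Z n m] (weight P).
Proof.
have me Q : measurable_fun [set: dataset Z n m]
    (fun x => expR (- (eps / (4 * tau) * score x Q))).
  apply: (measurableT_comp (@measurable_expR R)).
  apply: measurable_funN.
  by apply: measurable_funM => //; exact: measurable_bigmaxr.
apply: measurable_funM => //.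
have [P0 P0h] := fset0Pn _ hyps0.
pose W x := \sum_(Q <- hyps) expR (- (eps / (4 * tau) * score x Q)).
have W0 x : 0 < W x by exact: exp_mech_norm_gt0 P0h.
(* The normalizer is positive, so its inverse is an exponential of a logarithm, both measurable. *)
have -> : (fun x => (W x)^-1) = (fun x => expR (- ln (W x))).
  by apply/funext => x; rewrite expRN lnK// posrE.
apply: (measurableT_comp (@measurable_expR R)).
apply: measurable_funN.
apply: (measurableT_comp (@measurable_ln R)).
exact: measurable_sum.
Qed.

Let score_sensitivity (x x' : dataset Z n m) P :
  user_neighbors x x' -> score x P <= score x' P + 2 * tau.
Proof.
move=> xx'; rewrite /score big_seq; apply: bigmax_le => [|Q Qh].
  rewrite addr_ge0//; last by rewrite mulr_ge0// ltW.
  exact: bigmax_ge_id.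
apply: (@le_trans _ _ (dev P Q x' + 2 * tau)).
  apply: (@user_neighbors_sum _ _ _ _ _ _
    (fun y => F P Q (hits R (S P Q) y)) _ _ _ xx') => y.
  by rewrite clip_bounds// ltW.
rewrite lerD2r.
exact: (@le_bigmax_seq _ _ _ _ 0 Q xpredT (fun Q => dev P Q x')).
Qed.

Let L : R := ln (#|` hyps|%:R / beta).

Let card_hyps : 1 <= #|` hyps|%:R :> R.
Proof. by rewrite ler1n cardfs_gt0. Qed.

(** With [k] hypotheses, [k * expR (- (2 * L))] is [beta ^+ 2 / k], and [beta < 1 / 10] supplies the
    factor 10. *)
Let log_bound (y : R) : 2 * L <= y -> #|` hyps|%:R * expR (- y) <= beta / 10.
Proof.
case/andP: beta01 => b0 b1 hy.
set k := #|` hyps|%:R; have k0 : 0 < k by exact: lt_le_trans card_hyps.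
have -> : beta / 10 = k * (beta / (10 * k)) by field; rewrite lt0r_neq0.
rewrite ler_pM2l//; apply: (@le_trans _ _ (expR (- (2 * L)))).
  by rewrite ler_expR lerN2.
rewrite expRN mulr_natl mulr2n expRD /L lnK ?posrE ?divr_gt0// -/k.
have -> : (k / beta * (k / beta))^-1 = (beta / (10 * k)) * (10 * beta / k).
  by field; rewrite !lt0r_neq0.
rewrite ger_pMr ?divr_gt0 ?mulr_gt0// ler_pdivrMr// mul1r.
by apply: le_trans card_hyps; lra.
Qed.

(** * Utility for a sufficiently large number of users *)

Section utility.
Hypothesis large_n :
  6400 * sample_complexity #|` hyps| m alpha beta eps <= n%:R.
Variables (D : probability Z R) (P0 : hypothesis Z R).
Hypothesis P0h : P0 \in hyps.
Hypothesis P0D : (dTV P0 D <= (alpha / 10)%:E)%E.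

(** This [lam] minimizes [- lam * (alpha / 20) + 2 * lam ^+ 2 / m%:R], and the minimum is [- kappa];
    [alpha / 20] is the slack left in both tails. *)
Let lam : R := alpha * m%:R / 80.
Let kappa : R := alpha ^+ 2 * m%:R / 3200.

Let L_gt0 : 0 < L.
Proof.
case/andP: beta01 => b0 b1; apply: ln_gt0; rewrite ltr_pdivlMr// mul1r.
by apply: lt_le_trans card_hyps; lra.
Qed.

Let lam_small (l : R) : `|l| = lam -> `|l| / m%:R <= 1 / 2.
Proof.
move=> ->; rewrite /lam ler_pdivrMr//.
by have /andP[a0 a1] := alpha01; have := m0R; nra.
Qed.

(** The Lipschitz bound shifts the mean of [P0] by at most [alpha / 10], which is [5 / 100 * alpha]
    below the threshold. *)
Let upper_tail Q :
  (\int[iid (iid D m) n]_x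
     (expR (lam * (dev P0 Q x - n%:R * (15 / 100 * alpha))))%:E
   <= (expR (- (n%:R * kappa)))%:E)%E.
Proof.
have /andP[a0 a1] := alpha01.
have lam0 : 0 < lam by rewrite divr_gt0// mulr_gt0.
apply: integral_exp_deviation => //.
- exact: measurable_clip_freq.
- exact: slow_growth_clip_freq.
- by apply: lam_small; rewrite gtr0_norm.
rewrite -/(prob D (S P0 Q)); set q := prob D _.
have h : bin_mean q m (F P0 Q) 0 - mu P0 Q <= alpha / 10.
  have /dTV_leP/(_ _ (mS P0 Q)) := P0D; rewrite -/q /mu.
  set p := prob P0 _ => pq.
  have p01 := prob_bounds P0 (mS P0 Q); have q01 := prob_bounds D (mS P0 Q).
  rewrite -/p in p01; rewrite -/q in q01.
  have sF := slow_growth_clip_freq tau p m.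
  have [pq'|pq'] := leP p q.
    have /andP[_] := @bin_mean_monotone_lipschitz _ _ p q m _ 0
      ltac:(lra) pq' ltac:(lra) sF.
    move=> /le_trans; apply; rewrite mulfV ?lt0r_neq0// mul1r.
    by move: pq; rewrite ler_norml; lra.
  have /andP[+ _] := @bin_mean_monotone_lipschitz _ _ q p m _ 0
      ltac:(lra) (ltW pq') ltac:(lra) sF.
  by rewrite /F -/p; lra.
have -> : 2 * (lam ^+ 2 / m%:R) = kappa.
  by rewrite /lam /kappa; field; rewrite lt0r_neq0.
apply: (@le_trans _ _ (lam * (- (5 / 100 * alpha)) + kappa)).
  by rewrite lerD2r ler_pM2l//; lra.
rewrite /lam /kappa; lra.
Qed.

(** The set [S P P0] separates [D] from [P] by [(1 - 2 / 10 - 1 / 100) * alpha]; slope 1/2 leaves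
    [395 / 1000 * alpha], which exceeds the threshold by [5 / 100 * alpha]. *)
Let lower_tail P : (alpha%:E < dTV P D)%E ->
  (\int[iid (iid D m) n]_x
     (expR (- lam * (dev P P0 x - n%:R * (345 / 1000 * alpha))))%:E
   <= (expR (- (n%:R * kappa)))%:E)%E.
Proof.
move=> far; have /andP[a0 a1] := alpha01.
have lam0 : 0 < lam by rewrite divr_gt0// mulr_gt0.
apply: integral_exp_deviation => //.
- exact: measurable_clip_freq.
- exact: slow_growth_clip_freq.
- by apply: lam_small; rewrite normrN gtr0_norm.
rewrite -/(prob D (S P P0)); set q := prob D _.
have h : 395 / 1000 * alpha <= bin_mean q m (F P P0) 0 - mu P P0.
  have gap := Scheffe_set_gap (mS P P0) P0D (S_dTV P P0) far.
  have p01 := prob_bounds P (mS P P0); have q01 := prob_bounds D (mS P P0).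
  rewrite -/q in gap q01; rewrite /mu; set p := prob P _ in gap p01 *.
  (* The slope bound only covers gaps up to [alpha]; monotonicity carries it from [q'] to [q]. *)
  set q' := p + 79 / 100 * alpha.
  have sF := slow_growth_clip_freq tau p m.
  have /andP[h1 _] := @bin_mean_monotone_lipschitz _ _ q' q m _ 0
      ltac:(rewrite /q'; lra) ltac:(rewrite /q'; lra) ltac:(lra) sF.
  have := @bin_mean_clip_gap _ alpha p q' m m0 ltac:(lra) ltac:(lra)
     ltac:(rewrite /q'; lra) ltac:(rewrite /q'; lra) ltac:(rewrite /q'; lra).
  rewrite /= -/tau -/(F P P0); rewrite -/(F P P0) in h1.
  have -> : q' - p = 79 / 100 * alpha by rewrite /q'; ring.
  by move: h1; rewrite /F -/p; lra.
have -> : 2 * ((- lam) ^+ 2 / m%:R) = kappa.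
  by rewrite /lam /kappa; field; rewrite lt0r_neq0.
apply: (@le_trans _ _ (- lam * (5 / 100 * alpha) + kappa)).
  by rewrite lerD2r !mulNr lerN2 ler_pM2l//; lra.
rewrite /lam /kappa; lra.
Qed.

(** The last term of the sample complexity, with 6400 being twice the 3200 in [kappa]. *)
Let n_tail : 2 * L <= n%:R * kappa.
Proof.
have /andP[a0 a1] := alpha01.
have am0 : 0 < alpha ^+ 2 * m%:R by rewrite mulr_gt0// exprn_gt0.
have h1 : 0 <= L / eps by rewrite divr_ge0// ltW.
have h2 : 0 <= L / (alpha * eps * Num.sqrt m%:R).
  by rewrite divr_ge0 ?(ltW L_gt0)// !mulr_ge0// ltW.
have : 6400 * (L / (alpha ^+ 2 * m%:R)) <= n%:R.
  by apply: le_trans large_n; rewrite /sample_complexity -/L; lra.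
rewrite mulrA ler_pdivrMr// /kappa; lra.
Qed.

(** The first two terms sum to [L / (eps * alpha)] times [alpha + 1 / sqrt m], which cancels against
    [tau]. The factor [195 / 1000] is the gap between the thresholds [345 / 1000] and [15 / 100]. *)
Let n_mech :
  2 * L <= eps / (4 * tau) * (n%:R * (195 / 1000 * alpha)).
Proof.
have /andP[a0 a1] := alpha01.
set r := Num.sqrt m%:R : R; have r0 : 0 < r by rewrite sqrtr_gt0.
have h3 : 0 <= L / (alpha ^+ 2 * m%:R).
  by rewrite divr_ge0 ?(ltW L_gt0)// mulr_ge0// ?sqr_ge0.
have h : 6400 * (L / eps + L / (alpha * eps * r)) <= n%:R.
  by apply: le_trans large_n; rewrite /sample_complexity -/L -/r; lra.
rewrite [leRHS](_ : _ = n%:R * (eps * (195 / 1000 * alpha) / (4 * tau)));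
  last by ring.
have w0 : 0 <= eps * (195 / 1000 * alpha) / (4 * tau).
  apply: divr_ge0; last by have := tau0; lra.
  by apply: mulr_ge0; [exact: ltW | lra].
apply: le_trans (ler_wpM2r w0 h).
rewrite [leRHS](_ : _ = 52 * L); first by have := L_gt0; lra.
have s0 : alpha * r + 1 != 0.
  by rewrite gt_eqF// addr_gt0// mulr_gt0.
rewrite /tau -/r; field.
by rewrite s0 !lt0r_neq0.
Qed.

Lemma weight_utility : ((1 - beta)%:E <= \int[iid (iid D m) n]_x
  (\sum_(P <- hyps | (dTV P D <= alpha%:E)%E) weight P x)%:E)%E.
Proof.
have /andP[a0 a1] := alpha01; have /andP[b0 b1] := beta01.
have lam0 : 0 < lam by rewrite divr_gt0// mulr_gt0.
pose far := [seq P <- hyps | (alpha%:E < dTV P D)%E].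
pose E1 Q x := expR (lam * (dev P0 Q x - n%:R * (15 / 100 * alpha))).
pose E2 P x := expR (- lam * (dev P P0 x - n%:R * (345 / 1000 * alpha))).
pose H1 x := \sum_(Q <- hyps) E1 Q x.
pose H2 x := \sum_(P <- far) E2 P x.
have mE l P Q a : measurable_fun [set: dataset Z n m]
    (fun x => expR (l * (dev P Q x - a))).
  apply: (measurableT_comp (@measurable_expR R)); apply: measurable_funM => //.
  exact: measurable_funB.
have mH1 : measurable_fun [set: dataset Z n m] H1.
  by apply: measurable_sum => Q; exact: mE.
have mH2 : measurable_fun [set: dataset Z n m] H2.
  by apply: measurable_sum => Q; exact: mE.
have H10 x : 0 <= H1 x by rewrite sumr_ge0// => *; exact: expR_ge0.
have H20 x : 0 <= H2 x by rewrite sumr_ge0// => *; exact: expR_ge0.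
have kE : #|` hyps|%:R * expR (- (n%:R * kappa)) <= beta / 10.
  exact: log_bound n_tail.
have iH1 : (\int[iid (iid D m) n]_x (H1 x)%:E <= (beta / 10)%:E)%E.
  apply: (@le_trans _ _ (#|` hyps|%:R * expR (- (n%:R * kappa)))%:E);
    last by rewrite lee_fin.
  by apply: integral_sum_le => [Q|Q x|Q _];
    [exact: mE|exact: expR_ge0|exact: upper_tail].
have iH2 : (\int[iid (iid D m) n]_x (H2 x)%:E <= (beta / 10)%:E)%E.
  apply: (@le_trans _ _ ((size far)%:R * expR (- (n%:R * kappa)))%:E);
    last first.
    rewrite lee_fin; apply: le_trans kE; rewrite ler_wpM2r ?expR_ge0//.
    by rewrite ler_nat size_filter; exact: count_size.
  apply: integral_sum_le => [P|P x|P]; [exact: mE|exact: expR_ge0|].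
  by rewrite mem_filter => /andP[far_P _]; exact: lower_tail.
have iH := integral_add_le mH1 H10 mH2 H20 iH1 iH2.
have ib : (\int[iid (iid D m) n]_x (beta / 10)%:E <= (beta / 10)%:E)%E.
  rewrite integral_cst// [X in (_ * X)%E](_ : _ = 1%E) ?mule1//.
  exact: probability_setT.
have b10 : 0 <= beta / 10 by lra.
(* Three failure terms of [beta / 10] each: upper tails, lower tails and the mechanism. *)
have {}iH := integral_add_le (measurable_cst _) (fun=> b10)
  (measurable_funD mH1 mH2) (fun x => addr_ge0 (H10 x) (H20 x)) ib iH.
apply: (@le_trans _ _ (1 - (beta / 10 + (beta / 10 + beta / 10)))%:E).
  by rewrite lee_fin; lra.
apply: integral_ge_complement iH.
- under eq_fun do rewrite big_mkcond.
  apply: measurable_sum => P.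
  by case: (dTV P D <= alpha%:E)%E; [exact: measurable_weight|].
- by move=> x; rewrite sumr_ge0// => *; exact: exp_mech_ge0.
- apply: measurable_funD => //; exact: measurable_funD.
- by move=> x; rewrite !addr_ge0.
move=> x.
rewrite -[leLHS](exp_mech_sum1 (eps / (4 * tau)) (score x) P0h).
rewrite (bigID (fun P => (dTV P D <= alpha%:E)%E))/= lerD2l.
have bad_le1 : \sum_(P <- hyps | ~~ (dTV P D <= alpha%:E)%E) weight P x <= 1.
  rewrite -(exp_mech_sum1 (eps / (4 * tau)) (score x) P0h) big_mkcond/=.
  by apply: ler_sum => P _; case: ifP => _ //; exact: exp_mech_ge0.
(* If a deviation crosses its threshold, the matching exponential is at least 1 and dominates the
   weight of all bad hypotheses. *)
have [/hasP[Q Qh /= dQ]|near] :=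
    boolP (has (fun Q => n%:R * (15 / 100 * alpha) <= dev P0 Q x) hyps).
  apply: (le_trans bad_le1); apply: (@le_trans _ _ (E1 Q x)).
    by rewrite -[leLHS]expR0 ler_expR mulr_ge0 ?subr_ge0// ltW.
  have : E1 Q x <= H1 x.
    by rewrite /H1 (big_rem Q)//= lerDl sumr_ge0// => *; exact: expR_ge0.
  by have := H20 x; lra.
have [/hasP[P Pf /= dP]|dfar] :=
    boolP (has (fun P => dev P P0 x <= n%:R * (345 / 1000 * alpha)) far).
  apply: (le_trans bad_le1); apply: (@le_trans _ _ (E2 P x)).
    rewrite -[leLHS]expR0 ler_expR mulNr -mulrN.
    by rewrite mulr_ge0 ?oppr_ge0 ?subr_le0// ltW.
  have : E2 P x <= H2 x.
    by rewrite /H2 (big_rem P)//= lerDl sumr_ge0// => *; exact: expR_ge0.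
  by have := H10 x; lra.
(* No threshold is crossed: [P0] scores low, and every far hypothesis scores high through its
   comparison with [P0]. *)
apply: (@le_trans _ _ (beta / 10)); last by have := H10 x; have := H20 x; lra.
apply: le_trans (log_bound n_mech).
apply: (@exp_mech_utility _ _ _ _ _ (n%:R * (15 / 100 * alpha)) _ P0) => //.
  rewrite /score big_seq; apply: bigmax_le => [|Q Qh].
    by rewrite !mulr_ge0// ltW.
  by move/hasPn : near => /(_ _ Qh); rewrite -ltNge => /ltW.
move=> P Ph; rewrite -ltNge => Pfar.
have Pf : P \in far by rewrite mem_filter Pfar.
have /hasPn/(_ _ Pf) := dfar; rewrite -ltNge => /ltW h.
apply: (@le_trans _ _ (dev P P0 x)); first by apply: le_trans h; lra.
exact: (@le_bigmax_seq _ _ _ _ 0 P0 xpredT (fun Q => dev P Q x)).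
Qed.

End utility.

Lemma selection_kernel : exists A : R.-pker (dataset Z n m) ~> hypothesis Z R,
  [/\ user_level_DP eps A,
      forall x, A x [set` hyps] = 1%E
    & 6400 * sample_complexity #|` hyps| m alpha beta eps <= n%:R ->
      forall D : probability Z R,
        (\big[mine/+oo]_(P <- hyps) dTV P D <= (alpha / 10)%:E)%E ->
        ((1 - beta)%:E <=
         \int[iid (iid D m) n]_x
           A x [set P | P \in hyps /\ (dTV P D <= alpha%:E)%E])%E].
Proof.
have [P1 P1h] := fset0Pn _ hyps0.
have [A AE] := exists_mixture_kernel
  (fun P x => exp_mech_ge0 hyps (eps / (4 * tau)) (score x) P)
  measurable_weight
  (fun x => exp_mech_sum1 (eps / (4 * tau)) (score x) P1h).
exists A; split.
- move=> x x' xx' B _; rewrite !AE -EFinM lee_fin mulr_sumr.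
  apply: ler_sum => P _; rewrite [leRHS]mulrA ler_wpM2r//.
  have epsE : 2 * (eps / (4 * tau)) * (2 * tau) = eps.
    by field; rewrite lt0r_neq0.
  rewrite -{2}epsE.
  have xx'u Q : score x Q <= score x' Q + 2 * tau by exact: score_sensitivity.
  have x'xu Q : score x' Q <= score x Q + 2 * tau.
    by apply: score_sensitivity; exact: user_neighbors_sym.
  exact: exp_mech_private c0 P1h xx'u x'xu.
- move=> x; rewrite AE; congr EFin.
  rewrite -[RHS](exp_mech_sum1 (eps / (4 * tau)) (score x) P1h).
  rewrite big_seq [RHS]big_seq; apply: eq_bigr => P Ph.
  by rewrite indicE mem_set// mulr1.
move=> hn D /bigmine_le_exists[P0 P0h P0D].
under eq_integral => x _.
  rewrite AE (_ : \sum_(_ <- _) _ =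
    \sum_(P <- hyps | (dTV P D <= alpha%:E)%E) weight P x); last first.
    rewrite [RHS]big_mkcond/= big_seq [RHS]big_seq; apply: eq_bigr => P Ph.
    rewrite indicE; case: ifPn => hP.
      by rewrite mem_set ?mulr1.
    by rewrite memNset ?mulr0// => -[_]; exact/negP.
  over.
by have := weight_utility hn P0h P0D.
Qed.

End hypothesis_selection.

Theorem theoremE5 (R : realType) :
  exists (C : R) (c : nat), 0 < C /\
  forall (d : measure_display) (Z : measurableType d)
    (hyps : {fset hypothesis Z R}) (alpha beta eps : R) (n m : nat),
    hyps != fset0 ->
    0 < alpha < 1 / 10 -> 0 < beta < 1 / 10 -> 0 < eps -> (0 < m)%N ->
    exists A : R.-pker (dataset Z n m) ~> hypothesis Z R,
      [/\ user_level_DP eps A,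
          forall x, A x [set` hyps] = 1%E
        & polylog_scaled C c (sample_complexity #|` hyps| m alpha beta eps)
            <= n%:R ->
          forall D : probability Z R,
            (\big[mine/+oo]_(P <- hyps) dTV P D <= (alpha / 10)%:E)%E ->
            ((1 - beta)%:E <=
             \int[iid (iid D m) n]_x
               A x [set P | P \in hyps /\ (dTV P D <= alpha%:E)%E])%E].
Proof.
exists 6400, 0%N; split; first by rewrite ltr0n.
move=> d Z hyps alpha beta eps n m h0 ha hb he hm.
have a0 : 0 < alpha / 100 by case/andP: ha => a0 _; rewrite divr_gt0.
(* The distinguishing sets are fixed for all pairs at once, before any data or [D]; their slack
   [alpha / 100] enters the gap in [lower_tail]. *)
have /choice[S hS] (PQ : hypothesis Z R * hypothesis Z R) : exists A : set Z,
    measurable A /\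
    (dTV PQ.1 PQ.2 <= (prob PQ.2 A - prob PQ.1 A + alpha / 100)%:E)%E.
  by have [A mA hA] := near_Scheffe_set PQ.1 PQ.2 a0; exists A.
rewrite /polylog_scaled expr0 mulr1.
apply: (@selection_kernel _ _ _ _ _ _ _ _ _ (fun P Q => S (P, Q))
  h0 ha hb he hm) => P Q; by have [] := hS (P, Q).
Qed.
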